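(* For $n\ge0$ let $P_n(y)=\sum_{\pi\in\mathrm{UPF}(n)}y^{\#\{i:\ \text{car } i \text{ has displacement } 1\}}$, so $P_0(y)=1$. Then for $n\ge1$, $$P_n(y)=(y+1)\sum_{i=0}^{n-1}\binom{n-1}{i}P_i(y)P_{n-i-1}(y)-yP_{n-1}(y).$$
   Context: Classical parking: spots $1,\dots,n$, cars $1,\dots,n$ arrive in order with preferences $\pi=(\pi_1,\dots,\pi_n)$, and car $i$ parks in the first unoccupied spot among $\pi_i,\pi_i+1,\dots,n$; $\pi$ is a parking function if all cars park. The displacement of car $i$ is (spot where it parks) $-\pi_i$. $\mathrm{UPF}(n)$, the set of unit interval parking functions of length $n$, consists of the parking functions of length $n$ in which every car has displacement at most $1$. *)

(* Defs.v *)
From mathcomp Require Import all_boot all_order all_algebra.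

Set Implicit Arguments.
Unset Strict Implicit.
Unset Printing Implicit Defensive.

Import GRing.Theory.
Local Open Scope ring_scope.

(* Cars and spots 1, ..., n are represented by the ordinals 0, ..., n-1;      *)
(* shifting spots and preferences together leaves displacements unchanged.    *)

(* [enum 'I_n] is increasing, so this is the first spot at or after [p] that  *)
(* is not in [occ], or None if there is no such spot.                         *)
Definition first_free (n : nat) (occ : seq 'I_n) (p : 'I_n) : option 'I_n :=
  ohead [seq s : 'I_n <- enum 'I_n | (p <= s)%N && (s \notin occ)].

(* A car that finds no spot leaves without parking (None).                    *)
Fixpoint park (n : nat) (occ prefs : seq 'I_n) : seq (option 'I_n) :=
  if prefs is p :: ps then
    if first_free occ p is Some s then Some s :: park (s :: occ) ps
    else None :: park occ ps
  else [::].

Definition spot (n : nat) (pi : n.-tuple 'I_n) (i : 'I_n) : option 'I_n :=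
  nth None (park [::] pi) i.

Definition parking_function (n : nat) (pi : n.-tuple 'I_n) : bool :=
  [forall i, isSome (spot pi i)].

(* The value 0 for a car that does not park is a dummy, never used for        *)
(* parking functions.                                                         *)
Definition displacement (n : nat) (pi : n.-tuple 'I_n) (i : 'I_n) : nat :=
  if spot pi i is Some s then (s - tnth pi i)%N else 0%N.

Definition UPF (n : nat) : {set n.-tuple 'I_n} :=
  [set pi | parking_function pi & [forall i, (displacement pi i <= 1)%N]].

Definition P (n : nat) : {poly int} :=
  \sum_(pi in UPF n) 'X^#|[set i | displacement pi i == 1%N]|.

Lemma P0 : P 0 = 1.
Proof.
have defU : UPF 0 = [set [tuple]].
  by apply/setP=> t; rewrite !inE (tuple0 t) eqxx; apply/andP; split;
     apply/forallP; case.
rewrite /P defU big_set1 (_ : [set i | _] = set0) ?cards0 //.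
by apply/setP; case.
Qed.

(* Main.v *)
Require Import Defs.
From mathcomp Require Import all_boot all_order all_algebra.
From mathcomp Require Import zify ring.
Import GRing.Theory.
Local Open Scope ring_scope.

(** Weight a sequence of cars by [y] to the number of displaced cars. If the
    occupied spots just before the last car arrives are all but [s], that car
    prefers [s], or prefers [s - 1] when [s] is not the first spot, for a total
    weight [1 + y] ([1] if [s] is first). No car with displacement at most 1
    crosses the empty spot [s], so the earlier cars are a shuffle of two
    independent parkings, on the spots before [s] and on those after [s].
    Summing over [s] gives the recurrence; the missing weight for the first
    spot is the term [- y P_(n-1)]. *)

Set Implicit Arguments.
Unset Strict Implicit.

(** * Weights of runs and their two unfoldings *)

(** The free spot [s] is reached by preferring [s] itself, or an occupied [t]
    with [e t s], i.e. the spot just before [s]. *)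
Definition arrival_weight (R : comNzRingType) (y : R) (T : finType) (e : rel T)
    (O : {set T}) (s : T) : R :=
  1 + \sum_(t in O | e t s) y.

(** Runs of [k] cars ending with [S] occupied, unfolded from the last car. *)
Fixpoint fill_weight (R : comNzRingType) (y : R) (T : finType) (e : rel T)
    (k : nat) (S : {set T}) : R :=
  if k is k'.+1 then
    \sum_(s in S) arrival_weight y e (S :\ s) s * fill_weight y e k' (S :\ s)
  else 1.

(** Runs of [k] cars starting with [O] occupied, unfolded from the first car, as
    [park] does. *)
Fixpoint completion_weight (R : comNzRingType) (y : R) (T : finType) (e : rel T)
    (k : nat) (O : {set T}) : R :=
  if k is k'.+1 then
    \sum_(s in ~: O) arrival_weight y e O s * completion_weight y e k' (s |: O)
  else 1.

(** Car [j.+1] may end the filled part or start the completion: a set with a marked element [s]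
    corresponds to the set without [s] and a free spot [s]. *)
Lemma fill_completion_step (R : comNzRingType) (y : R) (T : finType) (e : rel T)
    (j k : nat) :
  \sum_(S : {set T} | #|S| == j.+1)
     fill_weight y e j.+1 S * completion_weight y e k S =
  \sum_(S : {set T} | #|S| == j)
     fill_weight y e j S * completion_weight y e k.+1 S.
Proof.
rewrite /=; under eq_bigr do rewrite big_distrl /=.
under [RHS]eq_bigr do rewrite big_distrr /=.
rewrite !pair_big_dep /=.
rewrite (reindex_onto (fun p : {set T} * T => (p.2 |: p.1, p.2))
                      (fun p : {set T} * T => (p.1 :\ p.2, p.2))) /=; last first.
  by move=> [S s] /= /andP[_ sS]; rewrite setD1K.
apply: eq_big => [[S s] /=|[S s] /= /andP[_ /eqP[->]]]; last first.
  by rewrite mulrAC mulrC mulrA.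
rewrite setU11 andbT inE.
(* If [s] is already in [S], the pair fails the round-trip condition of [reindex_onto]. *)
case: (boolP (s \in S)) => sS /=.
  rewrite andbF; apply/negbTE/nandP; right; apply/eqP=> -[] /setP/(_ s).
  by rewrite !inE eqxx sS.
by rewrite cardsU1 sS setU1K // eqxx eqSS !andbT.
Qed.

(** Cutting full runs after [j] cars gives a sum that does not depend on [j];
    compare [j = 0] and [j = #|T|]. *)
Lemma completion_weight_set0 (R : comNzRingType) (y : R) (T : finType)
    (e : rel T) :
  completion_weight y e #|T| set0 = fill_weight y e #|T| [set: T].
Proof.
have key j : (j <= #|T|)%N -> completion_weight y e #|T| set0 =
   \sum_(S : {set T} | #|S| == j)
     fill_weight y e j S * completion_weight y e (#|T| - j) S.
  elim: j => [_|j IH lt_j].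
    rewrite (big_pred1 set0) ?subn0 ?mul1r //= => S.
    by rewrite cards_eq0.
  by rewrite fill_completion_step (IH (ltnW lt_j)) -subSn // subSS.
rewrite (key #|T| (leqnn _)) (big_pred1 setT) ?subnn ?mulr1 // => S.
by rewrite -cardsT /= eqEcard subsetT eqn_leq subset_leq_card ?subsetT.
Qed.

(** * Shuffles of runs on separated sets *)

Lemma arrival_weight_separated (R : comNzRingType) (y : R) (T : finType)
    (e : rel T) (A B : {set T}) (s : T) :
  {in B, forall t, ~~ e t s} ->
  arrival_weight y e (A :|: B) s = arrival_weight y e A s.
Proof.
move=> sep; congr (1 + _); apply: eq_bigl => t; rewrite inE.
by case: (boolP (t \in B)) => [/sep/negbTE->|]; rewrite ?andbF ?orbF.
Qed.

(** The binomial counts the interleavings of the two runs. Removing the last car keeps the sets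
    separated, so induction on the total size applies. *)
Lemma fill_weight_separated (R : comNzRingType) (y : R) (T : finType)
    (e : rel T) (A B : {set T}) :
  [disjoint A & B] ->
  (forall a b, a \in A -> b \in B -> ~~ e a b && ~~ e b a) ->
  fill_weight y e (#|A| + #|B|) (A :|: B) =
  'C(#|A| + #|B|, #|A|)%:R * fill_weight y e #|A| A * fill_weight y e #|B| B.
Proof.
have [k] := ubnP (#|A| + #|B|)%N; elim: k A B => // k IH A B lek disAB sep.
case EA: #|A| => [|a].
  by move/cards0_eq: EA => ->; rewrite set0U bin0 !mul1r.
case EB: #|B| => [|b].
  by move/cards0_eq: EB => ->; rewrite setU0 addn0 binn mul1r mulr1.
(* Pascal's rule, according to whether the last car parks in [A] or in [B]. *)
rewrite addSn binS natrD [fill_weight _ _ _ (_ :|: _)]/=.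
rewrite (eq_bigl [predU A & B]); last by move=> s; rewrite !inE.
rewrite bigU //= addrC.
(* Stated for arbitrary sets because it is applied twice, the second time with [A] and [B]
   exchanged. *)
have half (A' B' : {set T}) (a' b' : nat) : #|A'| = a'.+1 -> #|B'| = b'.+1 ->
    (a'.+1 + b' < k)%N -> [disjoint A' & B'] ->
    (forall a b, a \in A' -> b \in B' -> ~~ e a b && ~~ e b a) ->
    \sum_(s in A') arrival_weight y e ((A' :|: B') :\ s) s *
       fill_weight y e (a' + b'.+1) ((A' :|: B') :\ s) =
    'C(a' + b'.+1, a')%:R * fill_weight y e a'.+1 A' * fill_weight y e b'.+1 B'.
  move=> EA' EB' lt dis' sep'.
  rewrite [fill_weight _ _ a'.+1 _]/= mulrAC big_distrr /=.
  apply: eq_bigr => s sA.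
  have sB : s \notin B' by rewrite (disjointFr dis' sA).
  rewrite setDUl (_ : B' :\ s = B'); last first.
    by apply/setDidPl; rewrite disjoint_sym disjoints1.
  rewrite arrival_weight_separated; last first.
    by move=> t tB; case/andP: (sep' _ _ sA tB).
  have Ca : #|A' :\ s| = a' by move: (cardsD1 s A'); rewrite sA EA'; case.
  have := IH (A' :\ s) B'; rewrite Ca EB' => -> //.
  - by rewrite [fill_weight _ _ b'.+1 _]/=; ring.
  - by rewrite addnS.
  - by apply: disjointWl dis'; apply: subD1set.
  - by move=> u v; rewrite inE => /andP[_ uA]; apply: sep'.
rewrite EA EB in lek.
rewrite (half A B a b) //; last by rewrite -ltnS -addnS.
rewrite setUC -addSnnS addnC (half B A b a) //; last 3 first.
- by move: lek; lia.
- by rewrite disjoint_sym.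
- by move=> u v uB vA; rewrite andbC; apply: sep.
have -> : 'C(b + a.+1, b) = 'C(b + a.+1, a.+1).
  by rewrite -bin_sub ?leq_addr // addKn.
by rewrite [fill_weight _ _ a.+1 _]/= [fill_weight _ _ b.+1 _]/=; ring.
Qed.

Lemma fill_weight_imset (R : comNzRingType) (y : R) (T T' : finType)
    (e : rel T) (e' : rel T') (f : T -> T') (k : nat) (S : {set T}) :
  injective f -> (forall a b, e' (f a) (f b) = e a b) ->
  fill_weight y e' k (f @: S) = fill_weight y e k S.
Proof.
move=> injf fe; elim: k S => //= k IH S.
rewrite big_imset /=; last by move=> u v _ _; apply: injf.
apply: eq_bigr => s sS.
have -> : (f @: S) :\ f s = f @: (S :\ s).
  apply/setP => u; rewrite !inE; apply/andP/imsetP.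
    case=> nu /imsetP[v vS E]; exists v => //; rewrite !inE vS andbT.
    by apply: contraNneq nu => <-; rewrite E.
  case=> v /setD1P[nv vS] ->; split; last exact: imset_f.
  by rewrite (inj_eq injf).
rewrite IH; congr (_ * _); congr (1 + _).
rewrite big_imset_cond /=; last by move=> u v _ _; apply: injf.
by apply: eq_bigl => t; rewrite fe.
Qed.

(** * From parking to run weights *)

Lemma ohead_filter_least (n : nat) (a : pred 'I_n) :
  if ohead [seq s <- enum 'I_n | a s] is Some s
  then a s /\ (forall t : 'I_n, a t -> (s <= t)%N)
  else a =1 xpred0.
Proof.
have srt : sorted (relpre val ltn) [seq s <- enum 'I_n | a s].
  apply: sorted_filter; first by move=> u v w; apply: ltn_trans.
  by rewrite -sorted_map val_enum_ord iota_ltn_sorted.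
have mem t : (t \in [seq s <- enum 'I_n | a s]) = a t.
  by rewrite mem_filter mem_enum andbT.
case: [seq s <- enum 'I_n | a s] srt mem => [|s l] /= srt mem.
  by move=> t; rewrite -mem.
split=> [|t]; first by rewrite -mem mem_head.
rewrite -mem inE => /predU1P[->//|tl]; apply: ltnW.
by move/(order_path_min (fun _ _ _ => @ltn_trans _ _ _))/allP/(_ _ tl): srt.
Qed.

Lemma first_free_someP (n : nat) (occ : seq 'I_n) (p s : 'I_n) :
  reflect [/\ (p <= s)%N, s \notin occ
            & forall t : 'I_n, (p <= t)%N -> t \notin occ -> (s <= t)%N]
          (first_free occ p == Some s).
Proof.
rewrite /first_free.
have := ohead_filter_least (fun t : 'I_n => (p <= t)%N && (t \notin occ)).
case: ohead => [s'|] H; apply: (iffP eqP) => //.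
- case=> <-; case: H => /andP[ps' s'occ] least; split=> // t pt tocc.
  by apply: least; rewrite pt.
- case=> ps socc least; congr Some; apply/val_inj/eqP => /=.
  case: H => /andP[ps' s'occ] least'.
  by rewrite eqn_leq least // least' // ps.
- by case=> ps socc _; move: (H s); rewrite ps socc.
Qed.

(** Justifies [arrival_weight]: a car displaced by exactly 1 was blocked only at its preferred
    spot. *)
Lemma first_free_near (n : nat) (occ : seq 'I_n) (p s : 'I_n) :
  s \notin occ ->
  (first_free occ p == Some s) && (s - p <= 1)%N =
  (p == s) || (p \in occ) && (p.+1 == s).
Proof.
move=> socc; apply/andP/orP => [[/first_free_someP[ps _ least] near]|].
  have [->|nps] := eqVneq p s; first by left.
  have ltps : (p < s)%N by rewrite ltn_neqAle nps.
  right; apply/andP; split; last by apply/eqP; lia.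
  by apply: contraLR ltps => pocc; rewrite -leqNgt least.
case=> [/eqP->|/andP[pocc /eqP E]].
  by rewrite subnn; split=> //; apply/first_free_someP; split.
split; last by lia.
apply/first_free_someP; split=> // [|t pt tocc]; first by rewrite -E.
rewrite -E ltn_neqAle pt andbT; apply: contraNneq tocc => E'.
by rewrite -(ord_inj E').
Qed.

Definition next_spot (n : nat) : rel 'I_n := fun t u => t.+1 == u.

(** The zeros let sums range over all preference tuples, with those outside [UPF n] vanishing. *)
Definition car_weight (n : nat) (o : option 'I_n) (p : 'I_n) : {poly int} :=
  if o is Some s then (if (s - p <= 1)%N then 'X^(s - p) else 0) else 0.

Definition run_weight (n : nat) (occ ps : seq 'I_n) : {poly int} :=
  \prod_(x <- zip (park occ ps) ps) car_weight x.1 x.2.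

(** Groups preferences by the spot reached; [F] stands for the rest of the run, which depends on the
    preference only through that spot. *)
Lemma sum_car_weight (n : nat) (occ : seq 'I_n) (F : option 'I_n -> {poly int}) :
  \sum_p car_weight (first_free occ p) p * F (first_free occ p) =
  \sum_(s in ~: [set t in occ])
     arrival_weight 'X (@next_spot n) [set t in occ] s *
     F (Some s).
Proof.
have expand (p : 'I_n) :
    car_weight (first_free occ p) p * F (first_free occ p) =
    \sum_(s in ~: [set t in occ])
       (if (first_free occ p == Some s) && (s - p <= 1)%N then 'X^(s - p) else 0)
       * F (Some s).
  case E: (first_free occ p) => [s|] /=; last first.
    by rewrite mul0r big1 // => s _; rewrite mul0r.
  have /eqP/first_free_someP[ps socc _] := E.
  rewrite (bigD1 s) ?inE //= eqxx /= big1 ?addr0 // => t /andP[_ nts].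
  by rewrite (inj_eq Some_inj) eq_sym (negbTE nts) mul0r.
rewrite (eq_bigr _ (fun p _ => expand p)) exchange_big /=.
apply: eq_bigr => s; rewrite !inE => socc; rewrite -big_distrl /=; congr (_ * _).
rewrite -big_mkcond /= (eq_bigl _ _ (fun p => first_free_near p socc)).
rewrite (bigD1 s) ?eqxx //= subnn expr0; congr (1 + _).
apply: eq_big => [p|p].
  rewrite inE; have [->|nps] := eqVneq p s; first by rewrite (negbTE socc).
  by rewrite andbT.
case/andP=> /orP[->//|/andP[_ /eqP E]] _; by rewrite -E subSnn.
Qed.

Lemma sum_run_weight (n k : nat) (occ : seq 'I_n) :
  \sum_(ps : k.-tuple 'I_n) run_weight occ ps =
  completion_weight 'X (@next_spot n) k [set t in occ].
Proof.
elim: k occ => [|k IH] occ /=.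
  rewrite (big_pred1 [tuple]) => [|t]; last by rewrite (tuple0 t) /= eqxx.
  by rewrite /run_weight big_nil.
rewrite (reindex (fun x : 'I_n * k.-tuple 'I_n => [tuple of x.1 :: x.2])) /=;
  last first.
  exists (fun t => (thead t, [tuple of behead t])) => [[p t] _|t _] /=.
    by rewrite theadE; congr pair; apply: val_inj.
  by rewrite -tuple_eta.
transitivity (\sum_p \sum_(t : k.-tuple 'I_n) run_weight occ (p :: t)).
  by rewrite pair_bigA.
pose F (o : option 'I_n) : {poly int} :=
  if o is Some s
  then completion_weight 'X (@next_spot n) k (s |: [set t in occ])
  else 0.
have term p : \sum_(t : k.-tuple 'I_n) run_weight occ (p :: t) =
    car_weight (first_free occ p) p * F (first_free occ p).
  rewrite /run_weight /=; case E: (first_free occ p) => [s|] /=; last first.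
    by rewrite mulr0 big1 // => t _; rewrite big_cons mul0r.
  under eq_bigr do rewrite big_cons /=.
  by rewrite -big_distrr /= IH set_cons.
rewrite (eq_bigr _ (fun p _ => term p)); exact: sum_car_weight.
Qed.

Lemma size_park (n : nat) (occ ps : seq 'I_n) : size (park occ ps) = size ps.
Proof. by elim: ps occ => //= p ps IH occ; case: first_free => [s|] /=; rewrite IH. Qed.

Lemma UPF_weight (n : nat) (pi : n.-tuple 'I_n) :
  run_weight [::] pi =
  if pi \in UPF n then 'X^#|[set i | displacement pi i == 1%N]| else 0.
Proof.
have -> : run_weight [::] pi = \prod_(i < n) car_weight (spot pi i) (tnth pi i).
  (* The default [ord0] for [big_nth] exists only when there is a spot. *)
  case: n pi => [|n] pi.
    by rewrite big_ord0 /run_weight (tuple0 pi) big_nil.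
  rewrite /run_weight (big_nth (None, ord0)) big_mkord.
  rewrite size_zip size_park minnn size_tuple; apply: eq_bigr => i _.
  by rewrite nth_zip ?size_park //= -tnth_nth.
rewrite inE; case: ifP => [/andP[/forallP parked /forallP near]|].
  rewrite -sum1_card -prodrXr [RHS]big_mkcond /=; apply: eq_bigr => i _.
  move: (parked i) (near i); rewrite inE /car_weight /displacement.
  case: (spot pi i) => // s _ le1; rewrite le1.
  by case: (s - _)%N le1 => [|[|]].
move/negbT; rewrite negb_and /parking_function !negb_forall.
case/orP=> /existsP[i]; rewrite /displacement => bad; rewrite (bigD1 i) //=.
  by move: bad; rewrite /car_weight; case: spot => //; rewrite mul0r.
move: bad; rewrite /car_weight; case: spot => // s /negbTE->.
by rewrite mul0r.
Qed.

(** * The recurrence *)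

Lemma P_fill_weight (n : nat) :
  P n = fill_weight 'X (@next_spot n) n [set: 'I_n].
Proof.
rewrite /P big_mkcond /=; under eq_bigr do rewrite -UPF_weight.
rewrite sum_run_weight (_ : [set t in [::]] = set0); last first.
  by apply/setP=> t; rewrite !inE.
by have := completion_weight_set0 ('X : {poly int}) (@next_spot n);
  rewrite card_ord.
Qed.

Unset Implicit Arguments.

Theorem theorem5p9 (n : nat) (hn : (1 <= n)%N) :
  P n = ('X + 1) * (\sum_(0 <= i < n) 'C(n.-1, i)%:R * P i * P (n - i - 1)%N)
        - 'X * P n.-1.
Proof.
case: n hn => // n _; rewrite succnK big_mkord.
have peel (s : 'I_n.+1) :
    arrival_weight 'X (@next_spot n.+1) ([set: 'I_n.+1] :\ s) s *
      fill_weight 'X (@next_spot n.+1) n ([set: 'I_n.+1] :\ s) =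
    (1 + (if s == ord0 then 0 else 'X)) *
      ('C(n, s)%:R * P s * P (n.+1 - s - 1)%N).
  have les : (s <= n)%N by rewrite -ltnS.
  have lt_l (i : 'I_s) : (i < n.+1)%N by apply: ltn_trans (ltn_ord s).
  have lt_r (i : 'I_(n.+1 - s - 1)) : (s.+1 + i < n.+1)%N.
    by have := ltn_ord i; lia.
  (* Embeddings of two shorter streets as the spots before and after [s]. *)
  pose l i := Ordinal (lt_l i); pose r i := Ordinal (lt_r i).
  have inj_l : injective l by move=> i j [/val_inj].
  have inj_r : injective r by move=> i j [/addnI/val_inj].
  have split : [set: 'I_n.+1] :\ s = l @: setT :|: r @: setT.
    apply/setP=> t; rewrite !inE andbT; apply/idP/orP.
      rewrite -val_eqE neq_ltn /= => /orP[lt|lt].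
        left; apply/imsetP; exists (Ordinal lt) => //; exact: val_inj.
      have lt' : (t - s.+1 < n.+1 - s - 1)%N by have := ltn_ord t; lia.
      right; apply/imsetP; exists (Ordinal lt') => //; apply: val_inj => /=.
      by rewrite subnKC.
    case=> /imsetP[i _ ->]; rewrite -val_eqE neq_ltn /=; first by rewrite ltn_ord.
    by rewrite leq_addr orbT.
  have card_l : #|l @: setT| = s by rewrite card_imset // cardsT card_ord.
  have card_r : #|r @: setT| = (n.+1 - s - 1)%N.
    by rewrite card_imset // cardsT card_ord.
  congr (_ * _).
    congr (1 + _); have [s0|s0] := eqVneq s ord0.
      by rewrite big1 // => t /andP[_]; rewrite s0.
    (* All spots but [s] are occupied, so its predecessor contributes the single ['X]. *)
    have lt' : (s.-1 < n.+1)%N by lia.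
    rewrite (big_pred1 (Ordinal lt')) // => t.
    rewrite !inE andbT /next_spot -!val_eqE /=; move: s0; rewrite -val_eqE /=; lia.
  have := @fill_weight_separated _ ('X : {poly int}) _ (@next_spot n.+1)
    (l @: setT) (r @: setT).
  rewrite card_l card_r -split (_ : s + (n.+1 - s - 1) = n)%N; last by lia.
  rewrite (@fill_weight_imset _ _ _ _ (@next_spot s) (@next_spot n.+1) l) //.
  rewrite (@fill_weight_imset _ _ _ _ (@next_spot (n.+1 - s - 1)%N) (@next_spot n.+1) r) //;
    last by move=> i j; rewrite /next_spot /=; lia.
  rewrite -!P_fill_weight; apply.
    apply/pred0P=> t /=; apply/negP=> /andP[/imsetP[i _ ->] /imsetP[j _ [E]]].
    by have := ltn_ord i; lia.
  move=> _ _ /imsetP[i _ ->] /imsetP[j _ ->]; rewrite /next_spot /=.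
  by have := ltn_ord i; lia.
rewrite P_fill_weight /=.
under eq_bigl do rewrite inE.
rewrite (eq_bigr _ (fun s _ => peel s)).
(* Isolate the first spot: its factor is 1 instead of [1 + 'X], a deficit of ['X * P 0 * P n], which
   is ['X * P n]. *)
rewrite !big_ord_recl /= bin0 subn0 subn1 P0.
rewrite -big_distrr /=; ring.
Qed.
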